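(* Let $q>1$ and $0<u<1$ be real numbers. Then, as an identity of power series in $x$ (the right-hand side being expanded in powers of $x$ at $x=0$), \[ \sum_{\lambda} x^{|\lambda|} M_{(u,q)}(\lambda) = \prod_{r=1}^{\infty} \frac{1-\frac{u}{q^r}}{1-\frac{ux}{q^r}}, \] where the sum is over all partitions $\lambda$ of all non-negative integers (including the empty partition).
   Context: A partition $\lambda$ of $n=|\lambda|\ge 0$ is a sequence $\lambda_1\ge\lambda_2\ge\cdots\ge 0$ of integers with $\sum_i\lambda_i=n$. For $i\ge 1$, $m_i(\lambda)$ denotes the number of parts of $\lambda$ equal to $i$. For real $q>1$ and integer $m\ge 0$, write $|GL(m,q)|=\prod_{i=0}^{m-1}(q^m-q^i)$ (so $|GL(0,q)|=1$); for $q$ a prime power this is the order of the general linear group over the field with $q$ elements. For $q>1$ and $0<u<1$, the measure $M_{(u,q)}$ on the set of all partitions of all non-negative integers is defined by \[ M_{(u,q)}(\lambda) = \Big[\prod_{r=1}^{\infty} \big(1-\tfrac{u}{q^r}\big)\Big] \frac{u^{|\lambda|}}{q^{2 [\sum_{1\le h<i} h\, m_h(\lambda) m_i(\lambda) + \frac{1}{2} \sum_{i\ge 1} (i-1) m_i(\lambda)^2]}\prod_{i\ge 1} |GL(m_i(\lambda),q)|}. \] *)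

(* Defs.v *)
From HB Require Import structures.
From mathcomp Require Import all_boot all_order all_algebra.
From mathcomp Require Import all_classical all_reals all_analysis.
Set Implicit Arguments.
Unset Strict Implicit.
Unset Printing Implicit Defensive.
Import Order.TTheory GRing.Theory Num.Theory.
Import numFieldNormedType.Exports.
Local Open Scope classical_set_scope.
Local Open Scope ring_scope.

(* A partition lambda_1 >= lambda_2 >= ... >= 0 is encoded by its finite,
   nonincreasing list of positive parts (the trailing zeros are dropped). *)
Definition is_intpart (s : seq nat) : bool := sorted geq s && (0%N \notin s).

Record intpart : Type :=
  IntPart { parts :> seq nat; parts_valid : is_intpart parts }.

HB.instance Definition _ := [isSub for parts].
HB.instance Definition _ := [Choice of intpart by <:].

Definition weight (l : intpart) : nat := sumn l.

Definition mult (i : nat) (l : intpart) : nat := count_mem i (parts l).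

Definition intparts_of (n : nat) : set intpart := [set l | weight l = n].

(* Guarantees that sums \sum_(l \in intparts_of n) are genuine sums: for an
   infinite support the library's \sum_(_ \in _) would default to 0. *)
Lemma finite_intparts_of (n : nat) : finite_set (intparts_of n).
Proof.
pose g (t : n.-tuple 'I_n.+1) : seq nat :=
  [seq i <- [seq nat_of_ord j | j <- t] | i != 0%N].
have fing : finite_set (g @` setT) by apply: finite_image; exact: finite_finset.
have fin_pre : finite_set (parts @^-1` (g @` setT)).
  by apply: finite_preimage fing => a b _ _ /val_inj.
apply: sub_finite_set fin_pre => -[s /= vs]; rewrite /intparts_of /weight /=.
move: vs => /andP[_ s0] sn.
have le_part i : i \in s -> (i <= n)%N.
  by move=> si; rewrite -sn (perm_sumn (perm_to_rem si)) /= leq_addr.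
have szs : (size s <= n)%N.
  rewrite -sn; elim: s s0 {sn le_part} => //= a s IH.
  rewrite inE negb_or eq_sym -lt0n => /andP[a0 /IH].
  by rewrite -add1n; exact: leq_add.
have szt : size ([seq inord i | i <- s] ++ nseq (n - size s) (@ord0 n)) == n.
  by rewrite size_cat size_map size_nseq subnKC.
exists (Tuple szt) => //; rewrite /g /= map_cat map_nseq filter_cat -map_comp.
rewrite [X in _ ++ X](_ : _ = [::]) ?cats0; last first.
  by elim: (n - size s)%N.
rewrite (_ : map _ s = s).
  by apply/all_filterP/allP => i si; apply: contraNneq s0 => <-.
by rewrite -[RHS]map_id; apply/eq_in_map => i /le_part ile /=; rewrite inordK.
Qed.

Section measure.
Context {R : realType}.
Implicit Types q u x : R.

Definition GLorder (m : nat) q : R := \prod_(i < m) (q ^+ m - q ^+ i).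

(* \prod_(r = 1)^\infty a r *)
Definition infprod (a : nat -> R) : R :=
  limn (fun N => \prod_(1 <= r < N.+1) a r).

(* The exponent of q, i.e.
     2 [ \sum_(1 <= h < i) h m_h m_i + 1/2 \sum_(i >= 1) (i - 1) m_i^2 ],
   with the factor 2 distributed so as to stay in nat. Here and in [M] the index
   stops at |l|, since m_i = 0 (and GLorder 0 q = 1) for i > |l|. *)
Definition qexponent (l : intpart) : nat :=
  (2 * (\sum_(1 <= i < (weight l).+1) \sum_(1 <= h < i) h * mult h l * mult i l)
   + \sum_(1 <= i < (weight l).+1) (i - 1) * mult i l ^ 2)%N.

Definition M u q (l : intpart) : R :=
  infprod (fun r => 1 - u / q ^+ r) *
  (u ^+ weight l /
   (q ^+ qexponent l *
    \prod_(1 <= i < (weight l).+1) GLorder (mult i l) q)).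

(* Coefficient of x^n in the power series \sum_l x^|l| (M u q l). *)
Definition gen_coef u q (n : nat) : R := \sum_(l \in intparts_of n) M u q l.

Definition rhs_factor u q x (r : nat) : R :=
  (1 - u / q ^+ r) / (1 - u * x / q ^+ r).

(* The power series \sum_n a_n x^n is the expansion of f at x = 0. *)
Definition expands_at0 (f : R -> R) (a : nat -> R) : Prop :=
  \forall x \near (0 : R), pseries a x @ \oo --> f x.

End measure.

(* Main.v *)
(* Put p = 1/q and let (p)_n = (1-p)...(1-p^n). Up to the constant
   \prod_r (1 - u/q^r) and the factor u^|l|, the measure gives l the mass
     p^(sum of the squares of the column lengths) / \prod_i (p)_(m_i).
   If l has k parts and its second column has length j, deleting the first
   column divides this mass by p^(k^2) / (p)_(k-j). By induction, through the
   q-Vandermonde identity, the partitions of n with k parts have total mass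
     p^(n + k(k-1)) [n-1, k-1]_p / (p)_k,
   and the sum over k is p^n / (p)_n, a degenerate Vandermonde sum. The series
   E(t) = \sum_n p^n t^n / (p)_n satisfies E(t) (1 - t p) = E(t p), hence
   E(t) = \prod_(r >= 1) 1 / (1 - t p^r), to be taken at t = u x. *)
Require Import Defs.
From mathcomp Require Import all_boot all_order all_algebra.
From mathcomp Require Import all_classical all_reals all_analysis.
From mathcomp Require Import finmap ring lra zify.
Import Order.TTheory GRing.Theory Num.Theory.
Import numFieldNormedType.Exports.
Local Open Scope classical_set_scope.
Local Open Scope ring_scope.

(** * q-Pochhammer symbols, Gaussian binomials and q-Vandermonde sums *)

Definition qpoch {R : nzRingType} (p : R) (n : nat) : R :=
  \prod_(i < n) (1 - p ^+ i.+1).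

(** The Gaussian binomial, given by Pascal's rule instead of a quotient of [qpoch], so that it is a
    polynomial in p and vanishes by itself for j > n. *)
Fixpoint qbin {R : nzRingType} (p : R) (n j : nat) : R :=
  match n, j with
  | _, 0%N => 1
  | 0%N, _.+1 => 0
  | n'.+1, j'.+1 => qbin p n' j' + p ^+ j * qbin p n' j
  end.

Arguments qbin : simpl never.

Lemma qpochS {R : comNzRingType} (p : R) (n : nat) :
  qpoch p n.+1 = qpoch p n * (1 - p ^+ n.+1).
Proof. by rewrite /qpoch big_ord_recr. Qed.

Lemma qpoch0 {R : nzRingType} (p : R) : qpoch p 0 = 1.
Proof. by rewrite /qpoch big_ord0. Qed.

Lemma qpoch_gt0 {R : realFieldType} (p : R) (n : nat) :
  0 <= p -> p < 1 -> 0 < qpoch p n.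
Proof.
move=> p0 p1; apply: prodr_gt0 => i _.
by rewrite subr_gt0 exprn_ilt1.
Qed.

Lemma qbin0 {R : nzRingType} (p : R) (n : nat) : qbin p n 0 = 1.
Proof. by case: n. Qed.

Lemma qbinS {R : nzRingType} (p : R) (n j : nat) :
  qbin p n.+1 j.+1 = qbin p n j + p ^+ j.+1 * qbin p n j.+1.
Proof. by []. Qed.

Lemma qbin_small {R : nzRingType} (p : R) (n j : nat) :
  (n < j)%N -> qbin p n j = 0.
Proof.
elim: n j => [|n IH] [|j] // nj.
rewrite qbinS !IH ?mulr0 ?addr0 //; exact: ltnW nj.
Qed.

Lemma qbin_qpoch {R : comNzRingType} (p : R) (m j : nat) :
  qbin p (m + j) j * (qpoch p j * qpoch p m) = qpoch p (m + j).
Proof.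
(* The two terms of Pascal's rule lower j and m respectively, hence the induction on m + j. *)
move: {2}(m + j)%N (erefl (m + j)%N) => n; elim: n m j => [|n IH] m [|j].
- by move=> /eqP; rewrite addn0 => /eqP ->; rewrite qbin0 qpoch0 !mul1r.
- by rewrite addnS.
- by move=> _; rewrite addn0 qbin0 qpoch0 !mul1r.
rewrite addnS => -[mjn]; rewrite qbinS mulrDl [in RHS]qpochS -(IH m j mjn).
case: m mjn => [|m] mjn.
  rewrite add0n (qbin_small _ _ _ (ltnSn j)) mulr0 mul0r addr0 qpochS; ring.
have := IH m j.+1; rewrite addnS -addSn => /(_ mjn) E.
rewrite [in LHS](qpochS _ m).
rewrite (_ : p ^+ j.+1 * _ * _ = p ^+ j.+1 * (1 - p ^+ m.+1) *
   (qbin p (m.+1 + j) j.+1 * (qpoch p j.+1 * qpoch p m))); last by ring.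
by rewrite E -(IH m.+1 j mjn) -(addnS m.+1) exprD !(qpochS p m) (qpochS p j); ring.
Qed.

(** Pascal's rule moved onto the summand: it drives the inductions of both Vandermonde sums
    below. *)
Lemma big_qbinS {R : comNzRingType} (p : R) (n : nat) (F : nat -> R) :
  \sum_(j < n.+2) qbin p n.+1 j * F j =
  \sum_(j < n.+1) qbin p n j * (F j.+1 + p ^+ j * F j).
Proof.
rewrite big_ord_recl qbin0 mul1r.
under eq_bigr do rewrite lift0 qbinS mulrDl.
under [RHS]eq_bigr do rewrite mulrDr.
rewrite !big_split /= addrCA; congr (_ + _).
rewrite [RHS]big_ord_recl [in LHS]big_ord_recr /= qbin0 mul1r expr0 mul1r.
rewrite qbin_small // mulr0 mul0r addr0; congr (_ + _).
by apply: eq_bigr => j _; rewrite /bump leq0n add1n mulrCA mulrA.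
Qed.

(* Pascal's rule in [n] turns the sum for [n.+1, s, k] into the one for
   [n, s.+1, k.+1]. *)
Lemma qVandermonde {R : comNzRingType} (p : R) (n s k : nat) :
  \sum_(j < n.+1) qbin p n j * (p ^+ (j * (j + s)) * qbin p k (j + s)) =
  qbin p (n + k) (n + s).
Proof.
elim: n s k => [|n IH] s k.
  by rewrite big_ord_recl big_ord0 /= addr0 !mul1r add0n.
rewrite (big_qbinS p n (fun j => p ^+ (j * (j + s)) * qbin p k (j + s))).
rewrite addSnnS addSnnS -IH; apply: eq_bigr => j _; congr (_ * _).
rewrite addnS qbinS mulrDr addrC !mulrA -!exprD addSn; congr (_ * _ + _ * _).
  by congr (_ ^+ _); lia.
by congr (_ ^+ _); lia.
Qed.

(** Formally the limit of [qVandermonde] as k grows, when [k, m]_p tends to 1/(p)_m. The induction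
    is the same, with Pascal's rule replaced by p^m/(p)_m + 1/(p)_(m-1) = 1/(p)_m. *)
Lemma qVandermonde_lim {R : fieldType} (p : R) (n s : nat) :
  (forall i, qpoch p i != 0) ->
  \sum_(j < n.+1) qbin p n j * (p ^+ (j * (j + s)) / qpoch p (j + s)) =
  (qpoch p (n + s))^-1.
Proof.
move=> p0; elim: n s => [|n IH] s.
  by rewrite big_ord_recl big_ord0 /= addr0 !mul1r add0n.
rewrite (big_qbinS p n (fun j => p ^+ (j * (j + s)) / qpoch p (j + s))).
rewrite addSnnS -IH; apply: eq_bigr => j _; congr (_ * _).
have := p0 (j + s).+1; rewrite addSn addnS qpochS.
rewrite mulf_eq0 negb_or => /andP[h1 h2].
rewrite (_ : (j.+1 * (j + s).+1 = j * (j + s) + j + (j + s).+1)%N); last by lia.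
rewrite (_ : (j * (j + s).+1 = j * (j + s) + j)%N); last by lia.
by rewrite !exprD; field; rewrite h2.
Qed.

(** * Adding and deleting the first column of a Young diagram *)

Lemma geq_trans : transitive geq.
Proof. by move=> y x z /= xy yz; exact: leq_trans yz xy. Qed.

Lemma mult0 (l : intpart) : mult 0 l = 0%N.
Proof. by case/andP: (parts_valid l) => _ /count_memPn. Qed.

(** A sorted list is determined by its counts, and 0 is never a part. Identities between partitions
    thus reduce to identities between multiplicities. *)
Lemma intpart_eq (l1 l2 : intpart) :
  (forall i, mult i.+1 l1 = mult i.+1 l2) -> l1 = l2.
Proof.
move=> E; apply: val_inj => /=.
have /andP[s1 _] := parts_valid l1; have /andP[s2 _] := parts_valid l2.
apply: (sorted_eq geq_trans _ s1 s2).
  by move=> x y /andP[/= xy yx]; apply/eqP; rewrite eqn_leq xy yx.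
by apply/allP => -[|i] _ /=; apply/eqP; [rewrite -!/(mult _ _) !mult0 | exact: E].
Qed.

(** Each row grows by one box, and rows of one box fill the new first column up to length k. If k <
    [size s], truncated subtraction adds no rows. *)
Definition add_column (k : nat) (s : seq nat) : seq nat :=
  [seq i.+1 | i <- s] ++ nseq (k - size s) 1%N.

Definition del_column (s : seq nat) : seq nat :=
  [seq i <- [seq i.-1 | i <- s] | i != 0%N].

Lemma add_column_valid (k : nat) (l : intpart) : is_intpart (add_column k l).
Proof.
have /andP[sl _] := parts_valid l; apply/andP; split; last first.
  rewrite mem_cat negb_or mem_nseq andbF andbT.
  by apply/mapP => -[].
rewrite (sorted_pairwise geq_trans) in sl.
rewrite (sorted_pairwise geq_trans) pairwise_cat pairwise_map.
apply/and3P; split.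
- by apply/allrelP => x y /mapP[z _ ->]; rewrite mem_nseq => /andP[_ /eqP ->].
- by apply: sub_pairwise sl => x y /=; rewrite ltnS.
- by elim: (k - _)%N => //= m ->; rewrite andbT; apply/allP => y /nseqP[->].
Qed.

Lemma del_column_valid (l : intpart) : is_intpart (del_column l).
Proof.
have /andP[sl _] := parts_valid l; apply/andP; split; last first.
  by rewrite mem_filter eqxx.
rewrite (sorted_pairwise geq_trans) in sl.
rewrite (sorted_pairwise geq_trans); apply: pairwise_filter.
by rewrite pairwise_map; apply: sub_pairwise sl => x y /=; lia.
Qed.

Definition intpart_add_column (k : nat) (l : intpart) : intpart :=
  IntPart (add_column_valid k l).

Definition intpart_del_column (l : intpart) : intpart :=
  IntPart (del_column_valid l).

Lemma mult_add_column (k i : nat) (l : intpart) :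
  mult i.+1 (intpart_add_column k l) =
  if i is 0 then (k - size l)%N else mult i l.
Proof.
rewrite /mult /= count_cat count_map count_nseq /=.
case: i => [|i] /=.
  by rewrite mul1n (_ : count _ _ = 0%N) //; exact: mult0.
by rewrite mul0n addn0; apply: eq_count => j /=; rewrite eqSS.
Qed.

Lemma mult_del_column (i : nat) (l : intpart) :
  mult i.+1 (intpart_del_column l) = mult i.+2 l.
Proof.
rewrite /mult /= count_filter count_map; apply: eq_count => -[|j] //=.
by rewrite eqSS; case: j => [|j] /=; rewrite ?andbT // andbF.
Qed.

Lemma size_add_column (k : nat) (l : intpart) :
  (size l <= k)%N -> size (intpart_add_column k l) = k.
Proof. by move=> lk; rewrite /= size_cat size_map size_nseq subnKC. Qed.

Lemma size_del_column (l : intpart) :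
  (size (intpart_del_column l) + mult 1 l)%N = size l.
Proof.
have /andP[_] := parts_valid l; rewrite /mult /= /del_column.
elim: (parts l) => //= -[|[|i]] s IH; rewrite ?inE //= => /IH; lia.
Qed.

Lemma weight_add_column (k : nat) (l : intpart) :
  (size l <= k)%N -> weight (intpart_add_column k l) = (weight l + k)%N.
Proof.
move=> lk; rewrite /weight /= sumn_cat sumn_nseq mul1n.
rewrite (_ : sumn _ = sumn l + size l)%N; first by rewrite -addnA subnKC.
by elim: (parts l) => //= i s ->; lia.
Qed.

Lemma weight_del_column (l : intpart) :
  (weight (intpart_del_column l) + size l)%N = weight l.
Proof.
have /andP[_] := parts_valid l; rewrite /weight /= /del_column.
elim: (parts l) => //= -[|[|i]] s IH; rewrite ?inE //= => /IH; lia.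
Qed.

Lemma add_columnK (k : nat) (l : intpart) :
  intpart_del_column (intpart_add_column k l) = l.
Proof.
by apply: intpart_eq => i; rewrite mult_del_column mult_add_column.
Qed.

Lemma del_columnK (l : intpart) :
  intpart_add_column (size l) (intpart_del_column l) = l.
Proof.
apply: intpart_eq => -[|i]; rewrite mult_add_column ?mult_del_column //.
by rewrite -[X in (X - _)%N]size_del_column addKn.
Qed.

(** * Effect of a new first column on the mass *)

Lemma mult_gt_weight (i : nat) (l : intpart) :
  (weight l < i)%N -> mult i l = 0%N.
Proof.
move=> li; apply/count_memPn; apply: contraL li => il.
by rewrite -leqNgt /weight (perm_sumn (perm_to_rem il)) leq_addr.
Qed.

Lemma size_mult (B : nat) (l : intpart) :
  (weight l < B)%N -> size l = (\sum_(1 <= i < B) mult i l)%N.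
Proof.
move=> lB; have /andP[_] := parts_valid l.
have : all (fun i => i < B)%N (parts l).
  by apply/allP => i il; apply: leq_ltn_trans lB; rewrite /weight
     (perm_sumn (perm_to_rem il)) leq_addr.
rewrite /mult; elim: (parts l) => /= [|a s IH]; first by rewrite big1.
rewrite inE negb_or => /andP[aB /IH {}IH] /andP[a0 /IH {}IH].
rewrite big_split /= -IH -add1n; congr (_ + _)%N.
rewrite (bigD1_seq a) ?iota_uniq ?mem_index_iota //=; last by rewrite aB; lia.
by rewrite eqxx big1 // => i /negbTE ia; rewrite eq_sym ia.
Qed.

(** For m = [mult], this turns the square of the number of parts into the pair sums that appear when
    every part grows by one. *)
Lemma sqr_sum (B : nat) (m : nat -> nat) :
  ((\sum_(1 <= i < B) m i) ^ 2 =
   \sum_(1 <= i < B) (2 * (\sum_(1 <= h < i) m h * m i) + m i ^ 2))%N.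
Proof.
elim: B => [|[|B] IH]; [by rewrite !big_geq..|].
rewrite !(@big_nat_recr _ _ _ B.+1 1) //= sqrnD IH -big_distrl /=; lia.
Qed.

(** The index ranges in the mass depend on the weight; two partitions can be compared once their
    ranges are widened to a common bound. *)
Lemma big_nat_widen_id {R : Type} {idx : R} (op : Monoid.law idx)
    (m n B : nat) (F : nat -> R) :
  (m <= n <= B)%N -> (forall i, (n <= i)%N -> F i = idx) ->
  \big[op/idx]_(m <= i < n) F i = \big[op/idx]_(m <= i < B) F i.
Proof.
move=> /andP[mn nB] F0; rewrite [RHS](@big_cat_nat _ _ _ n m B) //=.
rewrite [X in op _ X]big_nat_cond [X in op _ X]big1 ?Monoid.mulm1 //.
by move=> i /andP[/andP[ni _] _]; exact: F0.
Qed.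

Lemma qexponent_widen (B : nat) (l : intpart) : (weight l < B)%N ->
  qexponent l =
  (2 * (\sum_(1 <= i < B) \sum_(1 <= h < i) h * mult h l * mult i l)
   + \sum_(1 <= i < B) (i - 1) * mult i l ^ 2)%N.
Proof.
move=> lB; rewrite /qexponent.
congr (2 * _ + _)%N; apply: big_nat_widen_id => // i li.
  by rewrite mult_gt_weight // big1 // => h _; rewrite muln0.
by rewrite mult_gt_weight ?muln0.
Qed.

(** [qexponent] is the sum of the squared column lengths minus the sum of the m_i^2. The new column
    adds k^2, the new multiplicity m_1 = k - [size l] subtracts its square, and the other
    multiplicities only shift. *)
Lemma qexponent_add_column (k : nat) (l : intpart) : (size l <= k)%N ->
  (qexponent (intpart_add_column k l) + (k - size l) ^ 2 =
   qexponent l + k ^ 2)%N.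
Proof.
move=> lk; pose B := (weight l + k).+1.
have lB : (weight l < B)%N by rewrite ltnS leq_addr.
have lB' : (weight (intpart_add_column k l) < B.+1)%N.
  by rewrite weight_add_column // /B; lia.
rewrite (qexponent_widen _ _ lB) (qexponent_widen _ _ lB').
have sizeE := size_mult _ _ lB; have sqE := sqr_sum B (mult ^~ l).
rewrite -sizeE in sqE.
rewrite !(@big_nat_recl _ _ _ B 1) // big_geq // mult_add_column.
rewrite subnn mul0n !add0n.
rewrite (_ : \sum_(1 <= i < B) (i.+1 - 1) * _ ^ 2 =
  \sum_(1 <= i < B) i * mult i l ^ 2)%N; last first.
  by apply: eq_big_nat => -[|i] // _; rewrite subn1 mult_add_column.
(* Each new part 1 pairs with every old part, and an old pair h < i becomes h+1 < i+1, which
   contributes one more m_h m_i. *)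
rewrite (_ : \sum_(1 <= i < B) \sum_(1 <= h < i.+1) _ =
  \sum_(1 <= i < B) ((k - size l) * mult i l +
    (\sum_(1 <= h < i) h * mult h l * mult i l +
     \sum_(1 <= h < i) mult h l * mult i l)))%N; last first.
  apply: eq_big_nat => -[|i] // _; rewrite (@big_nat_recl _ _ _ i.+1 1) //.
  rewrite !mult_add_column mul1n -big_split; congr (_ + _)%N.
  apply: eq_big_nat => -[|h] // _.
  by rewrite mult_add_column mulSn mulnDl addnC.
rewrite (_ : \sum_(1 <= i < B) i * mult i l ^ 2 =
  \sum_(1 <= i < B) (i - 1) * mult i l ^ 2 +
  \sum_(1 <= i < B) mult i l ^ 2)%N; last first.
  rewrite -big_split; apply: eq_big_nat => -[|i] // _.
  by rewrite subn1 mulSn addnC.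
rewrite !big_split /= -!big_distrr /= -sizeE in sqE *.
(* This removes the truncated subtraction, so that the identity becomes polynomial. *)
have [a ->] : exists a, k = (a + size l)%N by exists (k - size l)%N; rewrite subnK.
rewrite addnK sqrnD sqE big1_eq; lia.
Qed.

(** Each factor is q^m (1 - q^(i-m)). The powers q^(m_i^2) extracted here compensate the negative
    squares in [qexponent]. *)
Lemma GLorder_qpoch {R : realType} (m : nat) (q : R) : q != 0 ->
  GLorder m q = q ^+ (m ^ 2) * qpoch q^-1 m.
Proof.
move=> q0; rewrite /GLorder /qpoch -mulnn exprM.
rewrite -[X in _ ^+ X * _](card_ord m) -prodr_const -big_split /=.
rewrite [RHS](reindex_inj rev_ord_inj) /=; apply: eq_bigr => i _.
rewrite subnSK // mulrBr mulr1 exprVn; congr (_ - _).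
by rewrite -[in q ^+ m](subnK (ltnW (ltn_ord i))) exprD mulrAC
  divff ?mul1r ?expf_neq0.
Qed.

(** The part of [M] that does not involve u. *)
Definition part_wt {R : realType} (q : R) (l : intpart) : R :=
  (q ^+ qexponent l *
   \prod_(1 <= i < (weight l).+1) GLorder (mult i l) q)^-1.

Lemma prod_GLorder_widen {R : realType} (q : R) (B : nat) (l : intpart) :
  (weight l < B)%N ->
  \prod_(1 <= i < (weight l).+1) GLorder (mult i l) q =
  \prod_(1 <= i < B) GLorder (mult i l) q.
Proof.
move=> lB; apply: big_nat_widen_id => // i li.
by rewrite mult_gt_weight // /GLorder big_ord0.
Qed.

(** The only new [GLorder] factor is that of the parts 1; its power of q is exactly the correction
    term in [qexponent_add_column]. *)
Lemma part_wt_add_column {R : realType} (q : R) (k : nat) (l : intpart) :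
  q != 0 -> (size l <= k)%N ->
  part_wt q (intpart_add_column k l) =
  q^-1 ^+ (k ^ 2) / qpoch q^-1 (k - size l) * part_wt q l.
Proof.
move=> q0 lk; pose B := (weight l + k).+1.
have lB : (weight l < B)%N by rewrite ltnS leq_addr.
have lB' : (weight (intpart_add_column k l) < B.+1)%N.
  by rewrite weight_add_column // /B; lia.
rewrite /part_wt (prod_GLorder_widen _ _ _ lB) (prod_GLorder_widen _ _ _ lB').
rewrite (@big_nat_recl _ _ _ B 1) // mult_add_column GLorder_qpoch //.
rewrite [X in _ * (_ * X)](_ : _ = \prod_(1 <= i < B) GLorder (mult i l) q);
  last first.
  by apply: eq_big_nat => -[|i] // _; rewrite mult_add_column.
rewrite !mulrA -exprD qexponent_add_column // exprD !invfM exprVn.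
ring.
Qed.

(** * Total mass of the partitions with given weight and number of parts *)

Lemma qbin_sym {R : fieldType} (p : R) (m j : nat) :
  (forall i, qpoch p i != 0) -> qbin p (m + j) j = qbin p (m + j) m.
Proof.
move=> p0; apply: (mulIf (mulf_neq0 (p0 j) (p0 m))).
by rewrite qbin_qpoch (mulrC (qpoch p j)) addnC qbin_qpoch.
Qed.

Lemma fsbig_partition {R : Type} {idx : R} (op : Monoid.com_law idx)
    {T : choiceType} (A : set T) (g : T -> nat) (B : nat) (F : T -> R) :
  finite_set A -> (forall x, A x -> (g x < B)%N) ->
  \big[op/idx]_(x \in A) F x =
  \big[op/idx]_(j < B) \big[op/idx]_(x \in A `&` [set x | g x = j]) F x.
Proof.
move=> Afin AB.
transitivity (\big[op/idx]_(j < B) \big[op/idx]_(x <- fset_set A)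
    if x \in [set x | g x = j] then F x else idx); last first.
  by apply: eq_bigr => j _; rewrite fsbig_mkcondr fsbig_finite.
rewrite exchange_big fsbig_finite //=; apply: eq_big_seq => x.
rewrite in_fset_set // => /set_mem/AB gB.
rewrite (bigD1 (Ordinal gB)) //= big1 ?Monoid.mulm1.
  by rewrite ifT //; exact: mem_set.
move=> j; case: ifPn => // /set_mem /= gj /eqP[].
exact: val_inj.
Qed.

Definition intparts_with (n k : nat) : set intpart :=
  intparts_of n `&` [set l | size l = k].

Lemma size_le_weight (l : intpart) : (size l <= weight l)%N.
Proof. by rewrite -weight_del_column leq_addl. Qed.

Lemma add_column_bij (n k : nat) :
  set_bij (intparts_of n `&` [set l | (size l <= k)%N]) (intparts_with (n + k) k)
    (intpart_add_column k).
Proof.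
split.
- move=> l [ln /= lk]; split; rewrite /= /intparts_of ?size_add_column //=.
  by rewrite weight_add_column // ln.
- by apply: in2W; exact: can_inj (add_columnK k).
- move=> l [ln /= lk]; exists (intpart_del_column l); last first.
    by rewrite -lk del_columnK.
  have := weight_del_column l; have := size_del_column l.
  move: ln; rewrite /intparts_of /= => ln; split => /=; last by lia.
  rewrite /intparts_of /=; lia.
Qed.

Definition weight_size_sum {R : realType} (q : R) (n k : nat) : R :=
  \sum_(l \in intparts_with n k) part_wt q l.

(** Here j is the length of the second column, that is, the number of parts left once the first
    column is deleted. *)
Lemma weight_size_sum_rec {R : realType} (q : R) (n k : nat) : q != 0 ->
  weight_size_sum q (n + k) k =
  \sum_(j < k.+1) q^-1 ^+ (k ^ 2) / qpoch q^-1 (k - j) * weight_size_sum q n j.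
Proof.
move=> q0; rewrite /weight_size_sum (reindex_fsbig _ _ _ _ (add_column_bij n k)).
rewrite (@fsbig_partition _ _ _ _ _ (fun l : intpart => size l) k.+1) //=.
- apply: eq_bigr => j _; rewrite mulr_fsumr.
  rewrite -setIA (_ : [set l : intpart | (size l <= k)%N] `&` _ =
      [set l : intpart | size l = j]); last first.
    apply/seteqP; split=> l /=; first by case.
    by move=> lj; split => //; rewrite lj -ltnS.
  apply: eq_fsbigr => l /set_mem [_ /= lj].
  by rewrite part_wt_add_column ?lj // -ltnS.
- exact/finite_setIl/finite_intparts_of.
- by move=> l [_].
Qed.

Lemma intparts_with_empty (n k : nat) : (n < k)%N -> intparts_with n k = set0.
Proof.
move=> nk; apply/seteqP; split=> l // [/= ln lk]; have := size_le_weight l.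
by rewrite lk ln leqNgt nk.
Qed.

Lemma weight_size_sum_small {R : realType} (q : R) (n k : nat) : (n < k)%N ->
  weight_size_sum q n k = 0.
Proof. by move=> nk; rewrite /weight_size_sum intparts_with_empty ?fsbig_set0. Qed.

Lemma weight_size_sumS0 {R : realType} (q : R) (n : nat) :
  weight_size_sum q n.+1 0 = 0.
Proof.
rewrite /weight_size_sum (_ : intparts_with _ _ = set0) ?fsbig_set0 //.
apply/seteqP; split=> l // [/= + /size0nil ln].
by rewrite /intparts_of /weight /= ln.
Qed.

Lemma weight_size_sum00 {R : realType} (q : R) : weight_size_sum q 0 0 = 1.
Proof.
pose l0 := @IntPart [::] isT.
rewrite /weight_size_sum (_ : intparts_with _ _ = [set l0]).
  rewrite fsbig_set1 /part_wt /weight /= /qexponent /weight /= !big_geq //.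
  by rewrite mulr1 invr1.
by apply/seteqP; split=> l /= => [[_ /= /size0nil ln]|->//]; exact: val_inj.
Qed.

(** Both indices are shifted by one to avoid n-1 and k-1. Deleting the first column, of length k+1,
    leaves weight n-k, so strong induction on n applies. *)
Lemma weight_size_sumSS {R : realType} (q : R) (n k : nat) : 1 < q ->
  weight_size_sum q n.+1 k.+1 =
  q^-1 ^+ (n.+1 + k * k.+1) * qbin q^-1 n k / qpoch q^-1 k.+1.
Proof.
move=> q1; have q0 : 0 < q by exact: lt_trans q1.
have p0 i : qpoch q^-1 i != 0.
  by rewrite gt_eqF // qpoch_gt0 ?invr_ge0 ?ltW // invf_lt1.
elim/ltn_ind: n k => n IH k.
case: (ltnP n k) => [nk|kn].
  by rewrite weight_size_sum_small // qbin_small // mulr0 mul0r.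
have [N En] : exists N, n = (N + k)%N by exists (n - k)%N; rewrite subnK.
rewrite {}En in IH *; rewrite -addnS weight_size_sum_rec ?gt_eqF //.
case: N IH => [|N] IH.
  (* All parts equal 1: the deletion leaves the empty partition, and only j = 0 survives. *)
  rewrite big_ord_recl /= weight_size_sum00 subn0 big1; last first.
    by move=> i _; rewrite weight_size_sum_small ?mulr0.
  rewrite !add0n addr0 mulr1 (_ : qbin _ _ _ = 1); last first.
    by have := qbin_sym q^-1 0 k p0; rewrite add0n qbin0.
  by rewrite mulr1; congr (_ ^+ _ / _); lia.
(* A nonempty partition remains, so the term j = 0 vanishes and the sum starts at j = i+1. *)
rewrite big_ord_recl /= weight_size_sumS0 mulr0 add0r.
pose p := q^-1; rewrite -/p.
transitivity (p ^+ (N.+1 + k.+1 + k * k.+1) / qpoch p k.+1 *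
   \sum_(i < k.+1) qbin p N i * (p ^+ (i * (i + 1)) * qbin p k.+1 (i + 1))).
  rewrite big_distrr /=; apply: eq_bigr => i _; rewrite IH /bump /=; last by lia.
  rewrite add1n subSS addn1 -/p.
  have ik : (i <= k)%N by rewrite -ltnS.
  have := qbin_qpoch p (k - i) i.+1; rewrite addnS subnK // => E.
  rewrite (_ : p ^+ (k.+1 ^ 2) = p ^+ k.+1 * p ^+ (k * k.+1)); last first.
    by rewrite -exprD; congr (_ ^+ _); lia.
  (* The factors (p)_(k-i) from the recursion and (p)_(i+1) from the induction hypothesis combine
     into a Gaussian binomial. *)
  have -> : qbin p k.+1 i.+1 = qpoch p k.+1 / (qpoch p i.+1 * qpoch p (k - i)).
    by rewrite -E mulfK // mulf_neq0 ?p0.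
  rewrite !exprD; move: (p0 (k - i)%N) (p0 i.+1) (p0 k.+1); rewrite -/p.
  move: (qpoch p _) (qpoch p _) (qpoch p _) => x y z x0 y0 z0.
  by field; rewrite x0 y0.
rewrite (_ : \sum_(i < k.+1) _ = qbin p (N.+1 + k) k).
  by rewrite mulrAC.
(* The symmetric form matches [qVandermonde] with s = 1. *)
have -> : qbin p (N.+1 + k) k = qbin p (N + k.+1) (N + 1).
  by rewrite qbin_sym // addSnnS addn1.
rewrite -qVandermonde.
(* The two sums stop at k and at N; both extend to N + k because one of the binomials vanishes
   beyond. *)
rewrite -!(big_mkord xpredT (fun i =>
  qbin p N i * (p ^+ (i * (i + 1)) * qbin p k.+1 (i + 1)))).
rewrite (@big_nat_widen_id _ _ _ 0 k.+1 (N + k).+1); first last.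
- by move=> i ki; rewrite (qbin_small _ k.+1) ?mulr0 // addn1.
- by lia.
rewrite (@big_nat_widen_id _ _ _ 0 N.+1 (N + k).+1) //; first by lia.
by move=> i ki; rewrite qbin_small ?mul0r.
Qed.

(** Summed over the number of parts, the closed form gives the left side of [qVandermonde_lim] with
    s = 1. *)
Lemma sum_part_wt {R : realType} (q : R) (n : nat) : 1 < q ->
  \sum_(l \in intparts_of n) part_wt q l = q^-1 ^+ n / qpoch q^-1 n.
Proof.
move=> q1; have q0 : 0 < q by exact: lt_trans q1.
have p0 i : qpoch q^-1 i != 0.
  by rewrite gt_eqF // qpoch_gt0 ?invr_ge0 ?ltW // invf_lt1.
rewrite (@fsbig_partition _ _ _ _ _ (fun l : intpart => size l) n.+1) //=;
  first last.
- by move=> l <-; rewrite ltnS size_le_weight.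
- exact: finite_intparts_of.
rewrite -/(\sum_(j < n.+1) weight_size_sum q n j).
case: n => [|n]; first by rewrite big_ord1 weight_size_sum00 qpoch0 divr1.
rewrite big_ord_recl [X in X + _]weight_size_sumS0 add0r.
rewrite -[in qpoch _ _]addn1 -qVandermonde_lim // big_distrr /=.
apply: eq_bigr => i _; rewrite [LHS]weight_size_sumSS // addn1 exprD.
by rewrite -!mulrA; congr (_ * _); rewrite mulrCA.
Qed.

(** * Euler's series and its infinite product *)

Definition euler_coef {R : fieldType} (p : R) (n : nat) : R :=
  p ^+ n / qpoch p n.

Lemma gen_coefE {R : realType} (u q : R) (n : nat) : 1 < q ->
  gen_coef u q n =
  infprod (fun r => 1 - u / q ^+ r) * (u ^+ n * euler_coef q^-1 n).
Proof.
move=> q1; rewrite /euler_coef -sum_part_wt // !mulr_fsumr.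
by apply: eq_fsbigr => l /set_mem ln; rewrite -[in u ^+ n]ln.
Qed.

(** Every factor of (p)_n is at least 1 - p. This crude geometric bound suffices, since only small x
    matter. *)
Lemma euler_coef_bound {R : realType} (p : R) (n : nat) : 0 < p -> p < 1 ->
  0 <= euler_coef p n <= (p / (1 - p)) ^+ n.
Proof.
move=> p0 p1; have q0 := qpoch_gt0 p n (ltW p0) p1.
have p1' : 0 < 1 - p by rewrite subr_gt0.
rewrite /euler_coef; apply/andP; split.
  by rewrite divr_ge0 ?exprn_ge0 ?ltW.
rewrite expr_div_n ler_pM2l ?exprn_gt0 //.
rewrite lef_pV2 ?posrE ?exprn_gt0 //.
elim: n {q0} => [|n IH]; first by rewrite qpoch0.
rewrite exprSr qpochS ler_pM ?exprn_ge0 ?(ltW p1') //.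
by rewrite lerB // exprS ger_pMr // exprn_ile1 ?ltW.
Qed.

Lemma euler_pseries_cvg {R : realType} (p t : R) : 0 < p -> p < 1 ->
  p / (1 - p) * `|t| < 1 -> cvgn (pseries (euler_coef p) t).
Proof.
move=> p0 p1 t1; apply: normed_cvg.
have r0 : 0 <= p / (1 - p) by rewrite divr_ge0 ?subr_ge0 ?ltW.
have g0 : 0 <= p / (1 - p) * `|t| by rewrite mulr_ge0.
apply: (@series_le_cvg _ _ (geometric 1 (p / (1 - p) * `|t|))) => [n|n|n|].
- exact: normr_ge0.
- by rewrite /= mul1r exprn_ge0.
- have /andP[e0 e1] := euler_coef_bound p n p0 p1.
  by rewrite /= mul1r normrM normrX exprMn ger0_norm // ler_wpM2r ?exprn_ge0.
- by apply: is_cvg_geometric_series; rewrite ger0_norm.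
Qed.

(* Small [t] gives a ratio at most 1/2, which avoids the exact radius of
   convergence and yields continuity of [euler] at 0. *)
Lemma euler_partial_bound {R : realType} (p t : R) (n : nat) : 0 < p -> p < 1 ->
  p / (1 - p) * `|t| <= 2^-1 ->
  `|pseries (euler_coef p) t n.+1 - 1| <= 2 * (p / (1 - p) * `|t|).
Proof.
move=> p0 p1 t1.
have r0 : 0 <= p / (1 - p) by rewrite divr_ge0 ?subr_ge0 ?ltW.
set x := p / (1 - p) * `|t| in t1 *.
have x0 : 0 <= x by rewrite mulr_ge0.
(* The statement is strengthened to make it inductive: the term of index n+1 is at most x^(n+1) <= x
   2^-n, and these bounds add up to 2 x (1 - 2^-n). *)
suff H : `|pseries (euler_coef p) t n.+1 - 1| <= 2 * x * (1 - 2^-1 ^+ n).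
  apply: le_trans H _; apply: ler_piMr; first by rewrite mulr_ge0.
  by rewrite gerBl exprn_ge0 // invr_ge0.
elim: n => [|n IH].
  rewrite /pseries /series /= big_nat1 /euler_coef qpoch0 !expr0 divr1 mulr1.
  by rewrite !subrr normr0 mulr0.
rewrite /pseries seriesSr addrAC (le_trans (ler_normD _ _)) //.
have -> : 2 * x * (1 - 2^-1 ^+ n.+1) =
   2 * x * (1 - 2^-1 ^+ n) + x * 2^-1 ^+ n by rewrite exprS; field.
apply: lerD; first exact: IH.
have /andP[e0 e1] := euler_coef_bound p n.+1 p0 p1.
rewrite normrM normrX ger0_norm //.
apply: (@le_trans _ _ (x ^+ n.+1)).
  by rewrite /x exprMn ler_wpM2r // exprn_ge0.
by rewrite exprS ler_wpM2l // lerXn2r ?nnegrE ?invr_ge0.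
Qed.

Definition euler {R : realType} (p t : R) : R := limn (pseries (euler_coef p) t).

Lemma euler_bound {R : realType} (p t : R) : 0 < p -> p < 1 ->
  p / (1 - p) * `|t| <= 2^-1 ->
  `|euler p t - 1| <= 2 * (p / (1 - p) * `|t|).
Proof.
move=> p0 p1 t1.
have cE : cvgn (pseries (euler_coef p) t).
  by apply: euler_pseries_cvg => //; apply: le_lt_trans t1 _; lra.
have L : `|pseries (euler_coef p) t n - 1| @[n --> \oo] --> `|euler p t - 1|.
  by apply: cvg_norm; apply: cvgB => //; exact: cvg_cst.
(* The empty partial sum is 0, not near 1, so n must be positive. *)
apply: cvgr_to_le L _; near=> n; rewrite -(@prednK n); last by near: n; exists 1%N.
exact: euler_partial_bound.
Unshelve. all: by end_near.
Qed.

(** From (1 - p^(n+1)) e_(n+1) = p e_n for the coefficients e_n, one gets E(t) - E(t p) = t p E(t),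
    already for partial sums with an index shift. *)
Lemma euler_rec {R : realType} (p t : R) : 0 < p -> p < 1 ->
  p / (1 - p) * `|t| < 1 ->
  euler p t * (1 - t * p) = euler p (t * p).
Proof.
move=> p0 p1 t1.
have r0 : 0 <= p / (1 - p) by rewrite divr_ge0 ?subr_ge0 ?ltW.
have ct := euler_pseries_cvg _ _ p0 p1 t1.
have ctp : cvgn (pseries (euler_coef p) (t * p)).
  apply: euler_pseries_cvg => //; apply: le_lt_trans t1.
  by rewrite ler_wpM2l // normrM ler_piMr // gtr0_norm // ltW.
have E n : pseries (euler_coef p) t n.+1 - pseries (euler_coef p) (t * p) n.+1 =
    t * p * pseries (euler_coef p) t n.
  elim: n => [|n IH].
    rewrite /pseries /series /= !big_nat1 big_geq // mulr0.
    by rewrite !expr0 subrr.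
  have := qpoch_gt0 p n.+1 (ltW p0) p1; have := qpoch_gt0 p n (ltW p0) p1.
  move=> /lt0r_neq0 h1; rewrite qpochS => /lt0r_neq0; rewrite mulf_eq0 negb_or.
  move=> /andP[_ h2].
  move: IH; rewrite /pseries => IH.
  rewrite !(seriesSr _ n.+1) [in RHS]seriesSr opprD addrACA IH mulrDr.
  congr (_ + _).
  by rewrite /euler_coef /= qpochS exprMn !exprS; field; rewrite h1 -exprS.
have L1 : pseries (euler_coef p) t n.+1 - pseries (euler_coef p) (t * p) n.+1
    @[n --> \oo] --> euler p t - euler p (t * p).
  by apply: cvgB; rewrite cvg_shiftS.
have L2 : pseries (euler_coef p) t n.+1 - pseries (euler_coef p) (t * p) n.+1
    @[n --> \oo] --> t * p * euler p t.
  by under eq_fun do rewrite E; apply: cvgM => //; exact: cvg_cst.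
have EE : euler p t - euler p (t * p) = t * p * euler p t.
  by apply: cvg_unique L1 L2; exact: norm_hausdorff.
rewrite mulrBr mulr1 mulrC -EE; ring.
Qed.

Lemma euler_prod {R : realType} (p t : R) (N : nat) : 0 < p -> p < 1 ->
  p / (1 - p) * `|t| < 1 ->
  euler p t * \prod_(1 <= r < N.+1) (1 - t * p ^+ r) = euler p (t * p ^+ N).
Proof.
move=> p0 p1 t1.
have r0 : 0 <= p / (1 - p) by rewrite divr_ge0 ?subr_ge0 ?ltW.
elim: N => [|N IH]; first by rewrite big_geq // expr0 !mulr1.
rewrite big_nat_recr //= mulrA IH exprSr !mulrA euler_rec //.
apply: le_lt_trans t1.
rewrite ler_wpM2l // normrM ler_piMr // ger0_norm ?exprn_ge0 ?(ltW p0) //.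
by rewrite exprn_ile1 // ltW.
Qed.

(** In [euler_prod] the right side E(t p^N) tends to 1, by continuity at 0. *)
Lemma euler_cvg {R : realType} (p t : R) : 0 < p -> p < 1 ->
  p / (1 - p) * `|t| < 2^-1 ->
  (\prod_(1 <= r < N.+1) (1 - t * p ^+ r))^-1 @[N --> \oo] --> euler p t.
Proof.
move=> p0 p1 t1.
have r0 : 0 <= p / (1 - p) by rewrite divr_ge0 ?subr_ge0 ?ltW.
(* The strict bound 1/2 gives |E(s) - 1| < 1, hence E(s) is nonzero and can be cancelled. *)
have bnd s : p / (1 - p) * `|s| < 2^-1 -> euler p s != 0.
  move=> s1; have := euler_bound _ _ p0 p1 (ltW s1).
  by apply: contraTneq => ->; rewrite sub0r normrN normr1 -ltNge; lra.
have ps N : p / (1 - p) * `|t * p ^+ N| <= p / (1 - p) * `|t| * p ^+ N.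
  by rewrite normrM mulrA (@ger0_norm _ (p ^+ N)) // exprn_ge0 // ltW.
have p1n N : p ^+ N <= 1 by rewrite exprn_ile1 // ltW.
have psmall N : p / (1 - p) * `|t * p ^+ N| < 2^-1.
  apply: le_lt_trans t1; apply: le_trans (ps N) _.
  by apply: ler_piMr; [rewrite mulr_ge0 | exact: p1n].
have lim1 : euler p (t * p ^+ N) @[N --> \oo] --> (1 : R).
  apply: cvg_zero; apply: norm_cvg0.
  apply: (@squeeze_cvgr _ _ _ _ (cst 0)
    (fun N => 2 * (p / (1 - p) * `|t|) * p ^+ N)).
  - near=> N; rewrite normr_ge0 /=.
    apply: le_trans (euler_bound _ _ p0 p1 (ltW (psmall N))) _.
    by rewrite -[leRHS]mulrA ler_wpM2l.
  - exact: cvg_cst.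
  - rewrite -[X in _ --> X](mulr0 (2 * (p / (1 - p) * `|t|))).
    by apply: cvgM; [exact: cvg_cst | apply: cvg_expr; rewrite gtr0_norm].
rewrite (_ : (fun N => _) = (fun N => euler p t * (euler p (t * p ^+ N))^-1)).
  have := cvgM (cvg_cst (euler p t)) (cvgV (oner_neq0 _) lim1).
  by rewrite invr1 mulr1; apply.
apply/funext => N; rewrite -euler_prod //; last by lra.
by rewrite invfM mulrA divff ?mul1r // bnd.
Unshelve. all: by end_near.
Qed.

(** * Expansion of the quotient of infinite products at 0 *)

Lemma cvg_prod_1B {R : realType} (u q : R) : 0 < u -> u < 1 -> 1 < q ->
  cvgn (fun N => \prod_(1 <= r < N.+1) (1 - u / q ^+ r)).
Proof.
move=> u0 u1 q1.
have f01 r : 0 <= 1 - u / q ^+ r <= 1.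
  have qr : 1 <= q ^+ r by rewrite exprn_ege1 // ltW.
  have qr0 : 0 < q ^+ r by exact: lt_le_trans qr.
  rewrite gerBl divr_ge0 ?(ltW u0) ?(ltW qr0) // andbT.
  rewrite subr_ge0 ler_pdivrMr // mul1r.
  exact: le_trans (ltW u1) qr.
have P0 N : 0 <= \prod_(1 <= r < N.+1) (1 - u / q ^+ r).
  by apply: prodr_ge0 => r _; case/andP: (f01 r).
apply: nonincreasing_is_cvgn; last by exists 0 => _ [N _ <-].
apply/nonincreasing_seqP => N; rewrite big_nat_recr //=.
by rewrite ler_piMr //; case/andP: (f01 N.+1).
Qed.

(** The first conjunct ensures that the [limn] inside [infprod] is a genuine limit and not a default
    value. *)
Theorem theorem3 (R : realType) (q u : R) (hq : 1 < q) (hu0 : 0 < u) (hu1 : u < 1) :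
  (\forall x \near (0 : R),
     cvgn (fun N => \prod_(1 <= r < N.+1) rhs_factor u q x r)) /\
  expands_at0 (fun x => infprod (rhs_factor u q x)) (gen_coef u q).
Proof.
pose p := q^-1; pose C := infprod (fun r => 1 - u / q ^+ r).
have q0 : 0 < q by exact: lt_trans hq.
have p0 : 0 < p by rewrite invr_gt0.
have p1 : p < 1 by rewrite invf_lt1.
have rho0 : 0 < p / (1 - p) by rewrite divr_gt0 ?subr_gt0.
(* On this neighbourhood of 0, [euler_cvg] applies at t = u x. *)
have small : \forall x \near (0 : R), p / (1 - p) * `|u * x| < 2^-1.
  near=> x; apply: (@le_lt_trans _ _ (p / (1 - p) * `|x|)).
    by rewrite ler_pM2l // normrM gtr0_norm // ler_piMl // ltW.
  rewrite -ltr_pdivlMl //; near: x.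
  by apply: (@nbhs0_lt R R); rewrite mulr_gt0 ?invr_gt0.
have prod_cvg x : p / (1 - p) * `|u * x| < 2^-1 ->
    \prod_(1 <= r < N.+1) rhs_factor u q x r @[N --> \oo] --> C * euler p (u * x).
  move=> xs.
  rewrite (_ : (fun N => _) = (fun N => \prod_(1 <= r < N.+1) (1 - u / q ^+ r) *
      (\prod_(1 <= r < N.+1) (1 - u * x * p ^+ r))^-1)).
    by apply: cvgM; [exact: cvg_prod_1B | exact: euler_cvg].
  apply/funext => N; rewrite prodf_div; congr (_ / _).
  by apply: eq_bigr => r _; rewrite exprVn.
split; first by near=> x; apply: cvgP; apply: prod_cvg; near: x.
rewrite /expands_at0; near=> x.
have xs : p / (1 - p) * `|u * x| < 2^-1 by near: x.
rewrite /infprod (cvg_lim (@norm_hausdorff _ _) (prod_cvg x xs)).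
(* The factor u^n of the n-th coefficient is absorbed into the argument u x. *)
rewrite (_ : pseries _ _ = (fun n => C * pseries (euler_coef p) (u * x) n)).
  apply: cvgM; first exact: cvg_cst.
  by apply: euler_pseries_cvg => //; apply: lt_trans xs _; lra.
apply/funext => n; rewrite /pseries /series /= big_distrr /=.
by apply: eq_bigr => k _; rewrite gen_coefE // exprMn /C; ring.
Unshelve. all: by end_near.
Qed.
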